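(* Let $q\ge 1$ be an integer, let $G$ be a simple connected graph with $n$ nodes and $m$ edges, and let $S_q(G)$ be the $q$-subdivision graph of $G$. Then $$\mathcal{K}(S_q(G))=\frac{2}{q}\mathcal{K}(G)+\bar{\mathcal{K}}(G)+\frac{q}{2}\tilde{\mathcal{K}}(G)+\frac{m^2q^2-n(n-1)}{2}.$$
   Context: The $q$-subdivision graph $S_q(G)$ is obtained from $G$ by replacing each edge $uv$ with $q$ disjoint paths of length $2$: $ux_1v,\ldots,ux_qv$. For a connected graph $G$ with node degrees $d_i$, the resistance distance $r_{ij}$ is the effective resistance between $i$ and $j$ when each edge is replaced by a unit resistor. The Kirchhoff index is $\mathcal K(G)=\sum_{\{i,j\}\subseteq V(G)}r_{ij}$, the additive degree-Kirchhoff index is $\bar{\mathcal K}(G)=\sum_{\{i,j\}\subseteq V(G)}(d_i+d_j)r_{ij}$, and the multiplicative degree-Kirchhoff index is $\tilde{\mathcal K}(G)=\sum_{\{i,j\}\subseteq V(G)}d_id_jr_{ij}$, the sums being over unordered pairs of nodes. *)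

(* Defs.v *)
From HB Require Import structures.
From mathcomp Require Import all_boot all_order all_algebra.

Set Implicit Arguments.
Unset Strict Implicit.
Unset Printing Implicit Defensive.

Import Order.TTheory GRing.Theory Num.Theory.
Local Open Scope ring_scope.

Record sgraph := SGraph {
  node :> finType;
  adj : rel node;
  adj_sym : symmetric adj;
  adj_irrefl : irreflexive adj
}.
Arguments adj : clear implicits.

Definition edges (G : sgraph) : {set {set G}} :=
  [set E | [exists x, exists y, adj G x y && (E == [set x; y])]].

Definition degree (G : sgraph) (x : G) : nat := #|[set y | adj G x y]|.

Definition connected (G : sgraph) : Prop :=
  (0 < #|G|)%N /\ forall x y : G, connect (adj G) x y.

Section Subdivision.
Variables (q : nat) (G : sgraph).

(* [inr (E, k)] is the middle node of the [k]-th path of length 2 that replaces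
   the edge [E]. *)
Definition subdiv_node : finType :=
  (G + {E : {set G} | E \in edges G} * 'I_q)%type.

Definition subdiv_adj (a b : subdiv_node) : bool :=
  match a, b with
  | inl u, inr (E, _) => u \in val E
  | inr (E, _), inl u => u \in val E
  | _, _ => false
  end.

Lemma subdiv_adj_sym : symmetric subdiv_adj.
Proof. by move=> [u|[E k]] [v|[F l]]. Qed.

Lemma subdiv_adj_irrefl : irreflexive subdiv_adj.
Proof. by move=> [u|[E k]]. Qed.

Definition subdivision : sgraph := SGraph subdiv_adj_sym subdiv_adj_irrefl.

End Subdivision.

Section Resistance.
Variables (R : realFieldType) (G : sgraph).

(* [R^o] carries the vector space structure of [R] over itself. *)
Definition node_fun := {ffun G -> R^o}.

(* By Ohm's law the current from [x] to an adjacent [y] through a unit resistor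
   is [v x - v y]; [net_current v x] is the total current out of [x]. *)
Definition net_current (v : node_fun) : node_fun :=
  [ffun x => \sum_(y | adj G x y) (v x - v y)].

(* A unit current is injected at [i] and extracted at [j]. *)
Definition source (i j : G) : node_fun :=
  [ffun x => (x == i)%:R - (x == j)%:R].

(* [f^-1%VF] maps each element of the range of [f] to some preimage, so this is
   a potential obeying Kirchhoff's current law (lemma [potentialP]). It is
   determined up to a constant, which does not affect [resistance]
   (lemma [resistanceE]). *)
Definition potential (i j : G) : node_fun :=
  (linfun net_current)^-1%VF (source i j).

Definition resistance (i j : G) : R := potential i j i - potential i j j.

(* Sum over unordered pairs of distinct nodes, each pair being taken once, in
   the order of the enumeration of [G]; [F] is meant to be symmetric. *)
Definition pair_sum (F : G -> G -> R) : R :=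
  \sum_(i : G) \sum_(j : G | (enum_rank i < enum_rank j)%N) F i j.

Definition kirchhoff : R := pair_sum resistance.

Definition add_kirchhoff : R :=
  pair_sum (fun i j => ((degree i)%:R + (degree j)%:R) * resistance i j).

Definition mul_kirchhoff : R :=
  pair_sum (fun i j => (degree i)%:R * (degree j)%:R * resistance i j).

Fact net_current_is_linear : linear net_current.
Proof.
move=> a u v; apply/ffunP=> x; rewrite !ffunE scaler_sumr -big_split /=.
by apply: eq_bigr => y _; rewrite !ffunE scalerBr opprD addrACA.
Qed.

HB.instance Definition _ :=
  GRing.isLinear.Build R node_fun node_fun *:%R net_current
    net_current_is_linear.

Lemma sum_net_current (v : node_fun) : \sum_x net_current v x = 0.
Proof.
under eq_bigr do rewrite ffunE sumrB.
rewrite sumrB [X in _ - X](exchange_big_dep predT) //=; apply/eqP.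
rewrite subr_eq0; apply/eqP; apply: eq_bigr => x _.
by apply: eq_bigl => y; rewrite adj_sym.
Qed.

Lemma net_current_energy (v : node_fun) :
  2 * \sum_x v x * net_current v x =
  \sum_x \sum_(y | adj G x y) (v x - v y) ^+ 2.
Proof.
rewrite [2]mulr2n mulrDl mul1r.
have -> : \sum_x v x * net_current v x =
          \sum_x \sum_(y | adj G x y) v x * (v x - v y).
  by apply: eq_bigr => x _; rewrite ffunE mulr_sumr.
rewrite [X in _ + X](exchange_big_dep predT) //= -big_split /=.
apply: eq_bigr => x _.
rewrite [X in _ + X](eq_bigl (adj G x)) => [|y]; last by rewrite adj_sym.
rewrite -big_split /=; apply: eq_bigr => y _.
by rewrite -[v y - v x]opprB mulrN -mulrBl -expr2.
Qed.

Lemma net_current0 (v : node_fun) :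
  connected G -> net_current v = 0 -> forall x y, v x = v y.
Proof.
move=> [_ Gconn] v0.
have/eqP := net_current_energy v.
rewrite v0 big1 => [|x _]; last by rewrite ffunE mulr0.
have sq_ge0 x y : 0 <= (v x - v y) ^+ 2 by rewrite sqr_ge0.
rewrite mulr0 eq_sym psumr_eq0 => [/allP/= h x y|x _]; last exact: sumr_ge0.
have vadj a b : adj G a b -> v a = v b.
  move=> ab; have := h a (mem_index_enum a).
  rewrite psumr_eq0 // => /allP/(_ b (mem_index_enum b)).
  by rewrite /= ab /= sqrf_eq0 subr_eq0 => /eqP.
have/connectP[p] := Gconn x y.
by elim: p x => [x _ -> //|z p IHp x /= /andP[/vadj-> zp] e]; apply: IHp zp e.
Qed.

Lemma potentialP (i j : G) :
  connected G -> net_current (potential i j) = source i j.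
Proof.
move=> Gconn.
pose total (v : node_fun) : R^o := \sum_x v x.
have total_lin : linear total.
  move=> a u v; rewrite /total scaler_sumr -big_split /=.
  by apply: eq_bigr => x _; rewrite !ffunE.
pose totalL := HB.pack_for {linear node_fun -> R^o} total
  (GRing.isLinear.Build R node_fun R^o *:%R total total_lin).
have sum_delta k : \sum_(x : G) (x == k)%:R = 1 :> R.
  by rewrite (bigD1 k) //= eqxx big1 ?addr0 // => x /negPf->.
pose L := linfun net_current; pose S := linfun totalL.
have kerL : (lker L <= <[[ffun=> 1] : node_fun]>)%VS.
  apply/subvP=> v; rewrite memv_ker lfunE => /eqP/(net_current0 Gconn) v_cst.
  apply/vlineP; exists (v i); apply/ffunP=> x.
  by rewrite !ffunE (v_cst x i) /GRing.scale /= mulr1.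
have imL : (limg L <= lker S)%VS.
  apply/subvP=> _ /memv_imgP[v _ ->].
  by rewrite memv_ker !lfunE /=; apply/eqP/sum_net_current.
have src_S : source i j \in lker S.
  rewrite memv_ker lfunE /= /total.
  under eq_bigr do rewrite ffunE.
  by rewrite sumrB !sum_delta subrr.
have imS : (0 < \dim (limg S))%N.
  rewrite lt0n dimv_eq0; apply/eqP=> S0.
  have := memv_img S (memvf ([ffun x => (x == i)%:R] : node_fun)).
  rewrite S0 memv0 lfunE /= /total; under eq_bigr do rewrite ffunE.
  by rewrite sum_delta oner_eq0.
have dimL := limg_ker_dim L fullv; have dimS := limg_ker_dim S fullv.
rewrite !capfv in dimL dimS.
have := dimvS kerL; rewrite dim_vline => dker.
have imLE : limg L = lker S.
  apply/eqP; rewrite eqEdim imL /=.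
  rewrite -(leq_add2r (\dim (limg S))) dimS -dimL addnC leq_add2l.
  by apply: leq_trans imS; apply: leq_trans dker (leq_b1 _).
have/limg_lfunVK : source i j \in limg L by rewrite imLE.
by rewrite lfunE.
Qed.

Lemma resistanceE (i j : G) (v : node_fun) :
  connected G -> net_current v = source i j -> resistance i j = v i - v j.
Proof.
move=> Gconn vE; have := @net_current0 (potential i j - v) Gconn.
rewrite linearB /= potentialP // vE subrr => /(_ erefl i j).
rewrite !ffunE /resistance => /eqP; rewrite subr_eq => /eqP ->.
by rewrite addrAC [_ - v j - _]addrAC subrr add0r addrC.
Qed.

Lemma resistanceC (i j : G) :
  connected G -> resistance i j = resistance j i.
Proof.
move=> Gconn; rewrite (@resistanceE i j (- potential j i)) //.
  by rewrite !ffunE opprK addrC.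
by rewrite linearN /= potentialP //; apply/ffunP=> x; rewrite !ffunE opprB.
Qed.

End Resistance.

Arguments kirchhoff R G : clear implicits.
Arguments add_kirchhoff R G : clear implicits.
Arguments mul_kirchhoff R G : clear implicits.

(* Main.v *)
Require Import Defs.
From mathcomp Require Import all_boot all_order all_algebra.
From mathcomp Require Import ring.

Set Implicit Arguments.
Unset Strict Implicit.
Unset Printing Implicit Defensive.

Import GRing.Theory Num.Theory.
Local Open Scope ring_scope.

(** Fix a node [z] of a connected graph.  A Green kernel [g] based at [z] solves
    the Poisson equations L (g a) = delta_a - delta_z, where L is the graph
    Laplacian, and every resistance is read off from it:
    r_ab = g_aa - g_ab - g_ba + g_bb.  Hence ([weighted_pair_sum_green]) for
    every weight D on the nodes, the sum of D_a D_b r_ab over unordered pairs is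
      (sum_a D_a) (sum_a D_a g_aa) - sum_a sum_b D_a D_b g_ab.

    A Green kernel of S_q(G) can be written down from one of G
    ([subdivision_greenP]).  Extend a function on G to S_q(G) by giving each
    middle node the mean of the two ends of its edge.  The extension has no
    current at the middle nodes, and at the old nodes its Laplacian is q/2 times
    the one on G, since an edge has become q parallel paths of resistance 2.
    Moreover, for a middle node x of the edge uv,
      delta_x = (delta_u + delta_v) / 2 + L (delta_x / 2).
    So extending g in both variables, multiplying by 2/q, and adding 1/2 at the
    diagonal entries of the middle nodes gives a Green kernel of S_q(G).

    With D = 1 on S_q(G), the pair sum is the Kirchhoff index of S_q(G).
    Summing an extension over S_q(G) amounts to summing over G with weight
    D_i = 1 + q d_i / 2, and these weights have total n + q m, the number
    of nodes of S_q(G).  The double sum of the kernel therefore becomes the one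
    for the weight D on G, and the trace becomes sum_i D_i g_ii up to a
    correction ([trace_subdivision_green]) in which the off-diagonal terms
    combine to sum_i (L g_i)(i) = n - 1, which is Foster's theorem in disguise.
    Thus the index of S_q(G) is 2/q times the pair sum of
    D_i D_j r_ij over G, plus a constant; expanding D_i D_j gives the three
    indices of G. *)

(** * Green kernels and resistances *)

Section Green.
Variables (R : realFieldType) (H : sgraph).
Implicit Types (w : H -> R) (g : H -> H -> R).

(** This is [net_current] on plain functions with values in [R], which avoids
    finite functions with values in [R^o]. *)
Definition laplacian w (x : H) : R := \sum_(y | adj H x y) (w x - w y).

Definition green_kernel (z : H) g :=
  forall a x, laplacian (g a) x = (x == a)%:R - (x == z)%:R.

Lemma laplacianE w x : laplacian w x = net_current [ffun y => w y : R^o] x.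
Proof. by rewrite ffunE; apply: eq_bigr => y _; rewrite !ffunE. Qed.

Lemma laplacianD w w' x :
  laplacian (fun y => w y + w' y) x = laplacian w x + laplacian w' x.
Proof. by rewrite -big_split; apply: eq_bigr => y _ /=; rewrite opprD addrACA. Qed.

Lemma laplacianZ c w x : laplacian (fun y => c * w y) x = c * laplacian w x.
Proof. by rewrite mulr_sumr; apply: eq_bigr => y _; rewrite mulrBr. Qed.

Lemma sum_neighbours_const x (c : R) :
  \sum_(y | adj H x y) c = (degree x)%:R * c.
Proof.
rewrite sumr_const mulr_natl; congr (_ *+ _).
by apply: eq_card => y; rewrite inE.
Qed.

Lemma laplacian_degree w x :
  laplacian w x = (degree x)%:R * w x - \sum_(y | adj H x y) w y.
Proof. by rewrite /laplacian sumrB sum_neighbours_const. Qed.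

Lemma laplacian_delta (a x : H) :
  laplacian (fun y => (a == y)%:R) x =
  (degree x)%:R * (a == x)%:R - (adj H x a)%:R.
Proof.
rewrite laplacian_degree; congr (_ - _); rewrite big_mkcond (bigD1 a) //= eqxx.
rewrite big1 ?addr0 => [|y /negPf ya]; first by case: adj.
by rewrite eq_sym ya if_same.
Qed.

Lemma green_exists (z : H) : connected H -> exists g, green_kernel z g.
Proof.
move=> conn; exists (fun a x => potential R a z x) => a x.
have /ffunP/(_ x) := potentialP R a z conn.
by rewrite !ffunE.
Qed.

(** The difference of two rows of [g] is a potential for the unit current from
    [a] to [b], as the two sinks at [z] cancel. *)
Lemma resistance_green z g a b : connected H -> green_kernel z g ->
  resistance R a b = g a a - g a b - g b a + g b b.
Proof.
move=> conn gG.
rewrite (@resistanceE R H a b [ffun x => g a x - g b x : R^o]) //.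
  by rewrite !ffunE; ring.
apply/ffunP => x.
have -> : net_current [ffun x => g a x - g b x : R^o] x =
          laplacian (fun x => g a x + -1 * g b x) x.
  rewrite laplacianE ffunE [RHS]ffunE; apply: eq_bigr => y _.
  by rewrite !ffunE !mulN1r.
by rewrite laplacianD laplacianZ !gG !ffunE; ring.
Qed.

Lemma resistance_diag (a : H) : resistance R a a = 0.
Proof. exact: subrr. Qed.

Lemma pair_sum_double (F : H -> H -> R) :
  (forall i j, F i j = F j i) -> (forall i, F i i = 0) ->
  2 * pair_sum F = \sum_i \sum_j F i j.
Proof.
move=> Fsym F0.
(* The pairs in decreasing order contribute the same amount. *)
have swap : pair_sum F = \sum_i \sum_(j | (enum_rank j < enum_rank i)%N) F i j.
  rewrite /pair_sum (exchange_big_dep predT) //=.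
  by apply: eq_bigr => i _; apply: eq_bigr => j _.
rewrite [2]mulr2n mulrDl mul1r {2}swap -big_split; apply: eq_bigr => i _ /=.
rewrite [RHS](bigD1 i) //= F0 add0r.
rewrite [RHS](bigID (fun j => enum_rank i < enum_rank j)%N) /=.
congr (_ + _); apply: eq_bigl => j.
  by case: eqVneq => [->|]; rewrite ?ltnn ?andbT.
rewrite -leqNgt [in RHS]leq_eqVlt (inj_eq (@ord_inj _)) (inj_eq enum_rank_inj).
by case: eqVneq => [->|]; rewrite ?ltnn ?andbT.
Qed.

Lemma pair_sumD (F F' : H -> H -> R) :
  pair_sum (fun i j => F i j + F' i j) = pair_sum F + pair_sum F'.
Proof. by rewrite -big_split; apply: eq_bigr => i _; rewrite -big_split. Qed.

Lemma pair_sumZ c (F : H -> H -> R) :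
  pair_sum (fun i j => c * F i j) = c * pair_sum F.
Proof. by rewrite mulr_sumr; apply: eq_bigr => i _; rewrite mulr_sumr. Qed.

(** Over ordered pairs, each of the two diagonal terms of the resistance
    contributes the product of the total weight and the weighted trace. *)
Lemma weighted_pair_sum_green (z : H) g (D : H -> R) :
  connected H -> green_kernel z g ->
  pair_sum (fun i j => D i * D j * resistance R i j) =
  (\sum_i D i) * (\sum_i D i * g i i) - \sum_i \sum_j D i * D j * g i j.
Proof.
move=> conn gG; apply: (@mulfI _ 2); first by rewrite pnatr_eq0.
rewrite pair_sum_double => [|i j|i]; first last.
- by rewrite resistance_diag mulr0.
- by rewrite (@resistanceC R H i j conn) [D i * _]mulrC.
pose S := \sum_i D i; pose T := \sum_i D i * g i i.
pose Q := \sum_i \sum_j D i * D j * g i j.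
have Sl : \sum_i \sum_j D j * (D i * g i i) = S * T.
  by rewrite mulr_sumr; apply: eq_bigr => i _; rewrite -mulr_suml.
have Sr : \sum_i \sum_j D i * (D j * g j j) = S * T.
  by rewrite mulr_suml; apply: eq_bigr => i _; rewrite mulr_sumr.
have Qs : \sum_i \sum_j D i * D j * g j i = Q.
  rewrite exchange_big; apply: eq_bigr => i _; apply: eq_bigr => j _ /=.
  by rewrite [D j * _]mulrC.
transitivity (S * T + S * T - Q - Q); last by rewrite /S /T /Q; ring.
rewrite -{1}Sl -Sr -{2}Qs /Q -!sumrN -!big_split; apply: eq_bigr => i _ /=.
rewrite -!sumrN -!big_split; apply: eq_bigr => j _ /=.
by rewrite (resistance_green _ _ conn gG); ring.
Qed.

End Green.

(** * Sums over edges *)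

Section Edges.
Variables (R : realFieldType) (G : sgraph).
Local Notation edge := {E : {set G} | E \in edges G}.

Lemma adj_neq (u y : G) : adj G u y -> u != y.
Proof. by case: eqVneq => // ->; rewrite adj_irrefl. Qed.

Lemma sum_ends (u y : G) (F : G -> R) :
  adj G u y -> \sum_(i in [set u; y]) F i = F u + F y.
Proof. by move/adj_neq=> uy; rewrite big_setU1 ?big_set1 // inE. Qed.

(** The edges at [u] are in bijection with the neighbours of [u]. *)
Lemma sum_incident (u : G) (F : {set G} -> R) :
  \sum_(E : edge | u \in val E) F (val E) = \sum_(y | adj G u y) F [set u; y].
Proof.
rewrite -(big_sub_cond (mem (edges G)) (fun E : {set G} => u \in E)) /=.
rewrite -(big_imset (A := adj G u) (h := fun y => [set u; y])) /= => [|y y' uy uy'].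
  apply: eq_bigl => E; apply/andP/imsetP => [[]|[y uy ->]].
    rewrite inE => /existsP[a /existsP[b /andP[ab /eqP->]]].
    rewrite !inE => /orP[] /eqP ->; first by exists b.
    by exists a; [change (is_true (adj G b a)); rewrite adj_sym | rewrite setUC].
  rewrite !inE eqxx; split=> //; apply/existsP; exists u; apply/existsP.
  by exists y; rewrite eqxx andbT.
move=> /setP/(_ y); rewrite !inE eqxx orbT eq_sym.
by rewrite (negPf (adj_neq uy)) /= => /esym/eqP.
Qed.

(** Summing over edges and their ends is summing over arcs; every sum over the
    middle nodes of the subdivision is reduced to sums over [G] this way. *)
Lemma sum_edge_ends (F : G -> {set G} -> R) :
  \sum_(E : edge) \sum_(i in val E) F i (val E) =
  \sum_i \sum_(y | adj G i y) F i [set i; y].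
Proof.
rewrite (exchange_big_dep predT) //=; apply: eq_bigr => i _.
exact: (sum_incident i (F i)).
Qed.

Lemma edge_weight (E : edge) : \sum_(i in val E) 1 = 2 :> R.
Proof.
case: E => E /=; rewrite inE => /existsP[a /existsP[b /andP[ab /eqP->]]].
exact: sum_ends.
Qed.

Lemma handshake : \sum_(i : G) (degree i)%:R = 2 * #|edges G|%:R :> R.
Proof.
have <- : \sum_(E : edge) \sum_(i in val E) 1 = \sum_(i : G) (degree i)%:R :> R.
  rewrite (sum_edge_ends (fun _ _ => 1)); apply: eq_bigr => i _.
  by rewrite sum_neighbours_const mulr1.
under eq_bigr do rewrite edge_weight.
by rewrite sumr_const card_sig mulr_natr; congr (_ *+ _); apply: eq_card.
Qed.

End Edges.

(** * Harmonic extension to the subdivision *)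

Section Subdivision.
Variables (R : realFieldType) (q : nat) (G : sgraph).
Local Notation edge := {E : {set G} | E \in edges G}.
Local Notation S := (subdivision q G).
Implicit Types (w : G -> R) (a b : S).

(** The value at a middle node is the mean over its two neighbours, so the
    extension is harmonic there. *)
Definition ext w a : R :=
  match a with
  | inl u => w u
  | inr p => 2^-1 * \sum_(i in val p.1) w i
  end.

Definition is_middle a : R := if a is inr _ then 1 else 0.

(** The total weight that node [i] receives when every node of the subdivision
    spreads a unit mass evenly over the nodes of [G] that determine its value
    under [ext]: 1 from itself and 1/2 from each of the [q * degree i] middle
    nodes next to it. *)
Definition spread_weight (i : G) : R := 1 + q%:R / 2 * (degree i)%:R.

Lemma sum_copies (P : pred edge) (F : edge -> R) :
  \sum_(p : edge * 'I_q | P p.1) F p.1 = q%:R * \sum_(E | P E) F E.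
Proof.
rewrite (eq_bigl (fun p => P p.1 && predT p.2)) => [|p]; last by rewrite andbT.
rewrite -(pair_big P predT (fun E _ => F E)) mulr_sumr /=.
by apply: eq_bigr => E _; rewrite sumr_const card_ord mulr_natl.
Qed.

Lemma sum_subdivision (F : S -> R) (F' : edge -> R) :
  (forall p, F (inr p) = F' p.1) ->
  \sum_a F a = \sum_u F (inl u) + q%:R * \sum_E F' E.
Proof.
move=> FE; rewrite big_sumType /= -sum_copies; congr (_ + _).
by apply: eq_bigr => p _.
Qed.

Lemma extD w w' a : ext (fun i => w i + w' i) a = ext w a + ext w' a.
Proof. by case: a => [//|p] /=; rewrite big_split mulrDr. Qed.

Lemma extZ c w a : ext (fun i => c * w i) a = c * ext w a.
Proof. by case: a => [//|p] /=; rewrite -mulr_sumr mulrCA. Qed.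

Lemma eq_ext w w' a : w =1 w' -> ext w a = ext w' a.
Proof. by move=> E; case: a => [u|p] //=; under eq_bigr do rewrite E. Qed.

Lemma ext_const (c : R) a : ext (fun=> c) a = c.
Proof.
case: a => [//|p] /=; rewrite -[X in \sum_(_ in _) X]mulr1 -mulr_sumr edge_weight.
by rewrite mulrCA mulVf ?mulr1 // pnatr_eq0.
Qed.

Lemma sum_ext w : \sum_a ext w a = \sum_i spread_weight i * w i.
Proof.
rewrite (sum_subdivision (F' := fun E => 2^-1 * \sum_(i in val E) w i)) //=.
rewrite -mulr_sumr (sum_edge_ends (fun i _ => w i)) mulrA mulr_sumr -big_split.
by apply: eq_bigr => i _; rewrite sum_neighbours_const /spread_weight /=; ring.
Qed.

(** At an old node, each of the [q] copies of an edge uy contributes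
    w u - (w u + w y) / 2 = (w u - w y) / 2. *)
Lemma laplacian_ext w b :
  laplacian (ext w) b = if b is inl u then q%:R / 2 * laplacian w u else 0.
Proof.
case: b => [u|[E k]]; rewrite /laplacian big_sumType /=; last first.
  rewrite [X in _ + X]big_pred0 // addr0.
  rewrite (eq_bigl (mem (val E))); last by [].
  rewrite (eq_bigr (fun i => 2^-1 * (\sum_(j in val E) w j) * 1 - w i)); last first.
    by move=> i _; rewrite mulr1.
  rewrite sumrB -mulr_sumr edge_weight mulrAC mulVf ?pnatr_eq0 //.
  by rewrite mul1r subrr.
rewrite big_pred0 // add0r.
rewrite (eq_bigl (fun p : edge * 'I_q => u \in val p.1)); last by case.
rewrite (sum_copies (fun E => u \in val E)
  (fun E => w u - 2^-1 * \sum_(i in val E) w i)).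
rewrite (sum_incident u (fun E : {set G} => w u - 2^-1 * \sum_(i in E) w i)).
rewrite -mulrA; congr (_ * _); rewrite mulr_sumr; apply: eq_bigr => y uy.
by rewrite sum_ends //; field.
Qed.

Lemma ext_sum (I : finType) (P : pred I) (W : G -> I -> R) a :
  ext (fun i => \sum_(b | P b) W i b) a = \sum_(b | P b) ext (W^~ b) a.
Proof. by case: a => [//|p] /=; rewrite exchange_big mulr_sumr. Qed.

Lemma laplacian_ext_swap (W : G -> S -> R) a b :
  laplacian (fun b => ext (W^~ b) a) b = ext (fun i => laplacian (W i) b) a.
Proof.
rewrite /laplacian ext_sum; apply: eq_bigr => y _.
rewrite -[LHS]addrC -mulN1r -extZ -extD; apply: eq_ext => i.
by rewrite mulN1r addrC.
Qed.

(** The diagonal term compensates for the fact that the extended kernel sees a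
    source at a middle node as two half sources at the ends of its edge. *)
Definition subdivision_green (g : G -> G -> R) a b : R :=
  2 / q%:R * ext (fun i => ext (g i) b) a + is_middle a / 2 * (a == b)%:R.

Lemma degree_middle p : (degree (inr p : S))%:R = 2 :> R.
Proof.
rewrite -[LHS]mulr1 -sum_neighbours_const big_sumType /=.
rewrite [X in _ + X]big_pred0 => [|[]]; case: p => E k //=.
by rewrite addr0; apply: edge_weight.
Qed.

Lemma subdivision_greenP (z : G) g : (0 < q)%N ->
  green_kernel z g -> green_kernel (inl z : S) (subdivision_green g).
Proof.
move=> q_gt0 gG a b.
have q_neq0 : q%:R != 0 :> R by rewrite pnatr_eq0 -lt0n.
rewrite /subdivision_green laplacianD !laplacianZ laplacian_ext_swap laplacian_delta.
rewrite (eq_ext a (fun i => laplacian_ext (g i) b)).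
case: b => [u|p]; last first.
  rewrite ext_const mulr0 add0r degree_middle.
  case: p => E k; case: a => [v|p']; first by rewrite !mul0r subrr.
  have -> : (inr p' == inr (E, k) :> S) = (inr (E, k) == inr p' :> S).
    exact: eq_sym.
  by rewrite /= !subr0; field.
under eq_ext do rewrite gG.
rewrite extZ extD ext_const.
have -> : (inl u == inl z :> S) = (u == z) by [].
case: a => [v|[E k]] /=.
  by have -> : (inl u == inl v :> S) = (u == v) by []; field.
have -> : \sum_(i in sval E) (u == i)%:R = (u \in sval E)%:R :> R.
  rewrite big_mkcond (bigD1 u) //= eqxx big1 ?addr0 => [|y /negPf yu].
    by case: (u \in _).
  by rewrite eq_sym yu if_same.
by field.
Qed.

(** A middle node of the edge ij averages [g] over {i, j} in both variables.
    The entries [g i j] with [i] and [j] adjacent that this produces are replaced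
    by diagonal ones using the Laplacian of [g i] at [i], and these Laplacians
    sum to n - 1. *)
Lemma trace_subdivision_green (z : G) g : (0 < q)%N -> green_kernel z g ->
  \sum_a subdivision_green g a a =
  2 / q%:R * (\sum_i spread_weight i * g i i) - (#|G|%:R - 1) / 2
    + q%:R * #|edges G|%:R / 2.
Proof.
move=> q_gt0 gG.
have q_neq0 : q%:R != 0 :> R by rewrite pnatr_eq0 -lt0n.
have lap_trace : \sum_i laplacian (g i) i = #|G|%:R - 1.
  under eq_bigr do rewrite gG eqxx.
  rewrite sumrB sumr_const; congr (_ - _).
  by rewrite (bigD1 z) //= eqxx big1 ?addr0 // => x /negPf->.
have edge_part :
    \sum_(E : edge) 2^-1 * (\sum_(i in val E) 2^-1 * \sum_(j in val E) g i j) =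
    \sum_i (2^-1 * (degree i)%:R * g i i - 4^-1 * laplacian (g i) i).
  rewrite -mulr_sumr.
  rewrite (sum_edge_ends (fun i (E : {set G}) => 2^-1 * \sum_(j in E) g i j)).
  rewrite mulr_sumr; apply: eq_bigr => i _.
  rewrite (eq_bigr (fun y => 2^-1 * (g i i + g i y))) => [|y iy].
    by rewrite -mulr_sumr big_split sum_neighbours_const laplacian_degree /=; field.
  by rewrite sum_ends.
rewrite (sum_subdivision (F' := fun E => 2 / q%:R *
  (2^-1 * \sum_(i in val E) 2^-1 * \sum_(j in val E) g i j) + 2^-1)); last first.
  by move=> p; rewrite /subdivision_green /= eqxx mul1r mulr1.
rewrite [X in _ + _ * X = _]big_split /= -mulr_sumr edge_part sumr_const card_sig.
rewrite sumrB -[X in _ - X]mulr_sumr lap_trace.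
under eq_bigr do rewrite /subdivision_green /= mul0r mul0r addr0.
rewrite -mulr_sumr.
have -> : \sum_i spread_weight i * g i i =
    \sum_i g i i + q%:R * \sum_i 2^-1 * (degree i)%:R * g i i.
  rewrite mulr_sumr -big_split; apply: eq_bigr => i _.
  by rewrite /spread_weight /=; field.
have -> : #|[pred E | E \in edges G]| = #|edges G| by apply: eq_card.
by rewrite -mulr_natl; field.
Qed.

Lemma sum_subdivision_green g :
  \sum_a \sum_b subdivision_green g a b =
  2 / q%:R * (\sum_i \sum_j spread_weight i * spread_weight j * g i j)
    + q%:R * #|edges G|%:R / 2.
Proof.
have row a : \sum_b subdivision_green g a b =
    2 / q%:R * ext (fun i => \sum_j spread_weight j * g i j) a + is_middle a / 2.
  rewrite big_split -!mulr_sumr -ext_sum; congr (_ * _ + _).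
    by apply: eq_ext => i; apply: sum_ext.
  rewrite (bigD1 a) //= eqxx big1 ?addr0 ?mulr1 // => b.
  by rewrite eq_sym => /negPf->.
under eq_bigr do rewrite row.
rewrite big_split -mulr_sumr sum_ext -mulr_suml; congr (_ * _ + _ / _).
  by apply: eq_bigr => i _; rewrite mulr_sumr; apply: eq_bigr => j _; rewrite mulrA.
rewrite (sum_subdivision (F' := fun=> 1)) // big1 // add0r sumr_const card_sig.
by congr (_ * _%:R); apply: eq_card.
Qed.

Lemma card_subdivision : #|S| = (#|G| + #|edges G| * q)%N.
Proof.
rewrite card_sum card_prod card_sig card_ord.
by congr (_ + _ * _)%N; apply: eq_card.
Qed.

Lemma sum_spread_weight : \sum_i spread_weight i = #|S|%:R.
Proof.
rewrite card_subdivision natrD natrM big_split -mulr_sumr handshake.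
have -> : \sum_(i : G) 1 = #|G|%:R :> R by rewrite sumr_const.
by rewrite /=; field.
Qed.

(** Each edge of [G] is traversed through its copy of index 0, which exists
    since [q > 0]. *)
Lemma subdivision_connected : (0 < q)%N -> connected G -> connected S.
Proof.
move=> q_gt0 [G_gt0 Gconn]; split; first by rewrite card_subdivision ltn_addr.
have Sym : connect_sym (adj S) by apply: sym_connect_sym; apply: adj_sym.
have edgeP (u v : G) : adj G u v -> [set u; v] \in edges G.
  by move=> uv; rewrite inE; apply/existsP; exists u; apply/existsP; exists v;
     rewrite uv eqxx.
have step (u v : G) : adj G u v -> connect (adj S) (inl u) (inl v).
  move=> uv; pose E : edge := Sub [set u; v] (edgeP u v uv).
  pose x : S := inr (E, Ordinal q_gt0).
  by apply: (@connect_trans _ _ x); apply: connect1; rewrite /= !inE eqxx ?orbT.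
have old (u v : G) : connect (adj S) (inl u) (inl v).
  have /connectP[p] := Gconn u v.
  elim: p u => [u _ -> //|y p IHp u /= /andP[uy yp] ve].
  exact: connect_trans (step u y uy) (IHp y yp ve).
have near a : exists u, connect (adj S) (inl u) a.
  case: a => [u|[[E E_edge] k]]; first by exists u.
  have := E_edge; rewrite inE => /existsP[u /existsP[v /andP[_ /eqP E_uv]]].
  by exists u; apply: connect1; rewrite /= E_uv !inE eqxx.
move=> a b; have [u ua] := near a; have [v vb] := near b.
by apply: connect_trans (connect_trans (old u v) vb); rewrite Sym.
Qed.

End Subdivision.

Theorem theorem6p6 (R : realFieldType) (q : nat) (hq : (1 <= q)%N)
    (G : sgraph) (hG : connected G) (n m : nat)
    (hn : #|G| = n) (hm : #|edges G| = m) :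
  kirchhoff R (subdivision q G) =
    2 / q%:R * kirchhoff R G + add_kirchhoff R G
    + q%:R / 2 * mul_kirchhoff R G
    + (m%:R ^+ 2 * q%:R ^+ 2 - n%:R * (n%:R - 1)) / 2.
Proof.
have /card_gt0P[z _] := hG.1.
have [g gG] := green_exists R z hG.
have hS := subdivision_connected hq hG.
have hGS := subdivision_greenP hq gG.
have q_neq0 : q%:R != 0 :> R by rewrite pnatr_eq0 -lt0n.
(* The Kirchhoff index is the weighted sum with all weights equal to 1. *)
have -> : kirchhoff R (subdivision q G) =
    pair_sum (fun a b : subdivision q G => 1 * 1 * resistance R a b).
  by apply: eq_bigr => a _; apply: eq_bigr => b _; rewrite !mul1r.
rewrite (weighted_pair_sum_green (fun=> 1) hS hGS) sumr_const.
have -> : \sum_(a : subdivision q G) 1 * subdivision_green g a a =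
    \sum_(a : subdivision q G) subdivision_green g a a.
  by apply: eq_bigr => a _; rewrite mul1r.
have -> : \sum_(a : subdivision q G) \sum_(b : subdivision q G)
      1 * 1 * subdivision_green g a b =
    \sum_(a : subdivision q G) \sum_(b : subdivision q G) subdivision_green g a b.
  by apply: eq_bigr => a _; apply: eq_bigr => b _; rewrite !mul1r.
rewrite (trace_subdivision_green hq gG) sum_subdivision_green.
have := weighted_pair_sum_green (spread_weight R q (G := G)) hG gG.
have -> : pair_sum (fun i j : G =>
      spread_weight R q i * spread_weight R q j * resistance R i j) =
    kirchhoff R G + q%:R / 2 * add_kirchhoff R G
    + (q%:R / 2) ^+ 2 * mul_kirchhoff R G.
  rewrite -!pair_sumZ -!pair_sumD.
  by apply: eq_bigr => i _; apply: eq_bigr => j _; rewrite /spread_weight; ring.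
rewrite sum_spread_weight card_subdivision natrD natrM hn hm.
set K := (X in X = _ -> _); set T := \sum_i spread_weight R q i * g i i.
set Q := \sum_i \sum_j _ => KE.
(* Eliminate the double sum of [g] in favour of the indices of [G]. *)
have -> : Q = (n%:R + m%:R * q%:R) * T - K by rewrite KE; ring.
by rewrite /K; field.
Qed.
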